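(* Let $M$ be a closed connected smooth manifold and let $G$ be a finite group acting faithfully and smoothly on $M$. If there is a smooth embedding of $M$ into $\mathbb{R}^d$, then there exists a $G$-equivariant smooth embedding of $M$ into $\mathbb{R}^{d|G|+1}$.
   Context: $|G|$ denotes the order of the finite group $G$. A smooth action of $G$ on $M$ is given by a homomorphism $\rho: G\to \mathrm{Diff}(M)$, where $\mathrm{Diff}(M)$ is the group of diffeomorphisms of $M$. An embedding $e: M\to\mathbb{R}^m$ is called $G$-equivariant if there is an orthogonal representation (group homomorphism) $\tilde\rho: G\to SO(m)$, with $SO(m)$ acting canonically on $\mathbb{R}^m$, such that $e\circ\rho(g)=\tilde\rho(g)\circ e$ for every $g\in G$. *)

(* Defs.v *)
From HB Require Import structures.
From mathcomp Require Import all_boot all_order all_algebra.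
From mathcomp Require Import fingroup mxrepresentation.
From mathcomp Require Import all_classical all_reals all_analysis.

Set Implicit Arguments.
Unset Strict Implicit.
Unset Printing Implicit Defensive.

Import Order.TTheory GRing.Theory Num.Theory.
Import numFieldNormedType.Exports.
Local Open Scope classical_set_scope.
Local Open Scope ring_scope.

(* Euclidean n-space is 'cV[R]_n (column vectors), so that square matrices act
   on it canonically by left multiplication. *)

(* f is C^k on the open set U. In finite dimension the differential
   x |-> 'd f x is C^k iff all of its evaluations x |-> 'd f x v are. *)
Fixpoint class_C (R : realType) (V W : normedModType R) (k : nat)
    (U : set V) (f : V -> W) : Prop :=
  match k with
  | 0%N => forall x, U x -> {for x, continuous f}
  | k'.+1 => (forall x, U x -> differentiable f x) /\
             (forall v, class_C k' U (fun x => 'd f x v))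
  end.

Definition smooth_on (R : realType) (V W : normedModType R)
    (U : set V) (f : V -> W) : Prop :=
  forall k, class_C k U f.

(* A chart is a homeomorphism from an open subset of M onto an open subset of
   R^n. Both directions are total functions: the map is only meaningful on
   chart_dom, the inverse only on the image of chart_dom. Requiring the image
   to be open in R^n is what excludes boundary points. *)
Record chart (R : realType) (n : nat) (M : topologicalType) := Chart {
  chart_dom : set M;
  chart_map :> M -> 'cV[R]_n;
  chart_inv : 'cV[R]_n -> M;
  chart_dom_open : open chart_dom;
  chart_img_open : open (chart_map @` chart_dom);
  chart_mapK : forall x, chart_dom x -> chart_inv (chart_map x) = x;
  chart_map_continuous :
    forall x, chart_dom x -> {for x, continuous chart_map};
  chart_inv_continuous :
    forall y, (chart_map @` chart_dom) y -> {for y, continuous chart_inv} }.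

(* The smooth structure is presented by an atlas that need not be maximal. *)
Record smooth_manifold (R : realType) (n : nat) := SmoothManifold {
  manifold_space :> topologicalType;
  atlas : set (chart R n manifold_space);
  manifold_hausdorff : hausdorff_space manifold_space;
  manifold_second_countable : @second_countable manifold_space;
  atlas_cover : forall x, exists2 c, atlas c & chart_dom c x;
  atlas_compatible : forall c c', atlas c -> atlas c' ->
    smooth_on (c @` (chart_dom c `&` chart_dom c')) (c' \o chart_inv c) }.

Definition closed_manifold (R : realType) (n : nat) (M : smooth_manifold R n) :=
  compact [set: M].

Definition connected_manifold (R : realType) (n : nat)
    (M : smooth_manifold R n) :=
  connected [set: M].

Definition smooth_map (R : realType) (m n : nat) (M : smooth_manifold R m)
    (N : smooth_manifold R n) (f : M -> N) : Prop :=
  continuous f /\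
  forall c c', atlas c -> atlas c' ->
    smooth_on (c @` (chart_dom c `&` f @^-1` (chart_dom c')))
              (c' \o f \o chart_inv c).

Definition diffeomorphism (R : realType) (m n : nat) (M : smooth_manifold R m)
    (N : smooth_manifold R n) (f : M -> N) : Prop :=
  smooth_map f /\
  exists g : N -> M, [/\ smooth_map g, cancel f g & cancel g f].

Definition smooth_to_euclidean (R : realType) (n d : nat)
    (M : smooth_manifold R n) (f : M -> 'cV[R]_d) : Prop :=
  forall c, atlas c -> smooth_on (c @` chart_dom c) (f \o chart_inv c).

Definition immersive (R : realType) (n d : nat)
    (M : smooth_manifold R n) (f : M -> 'cV[R]_d) : Prop :=
  forall c, atlas c -> forall x, chart_dom c x ->
    injective ('d (f \o chart_inv c) (c x)).

Definition topological_embedding (S T : topologicalType) (f : S -> T) : Prop :=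
  [/\ continuous f, injective f &
      forall U, open U -> exists2 V, open V & f @` U = range f `&` V].

Definition smooth_embedding (R : realType) (n d : nat)
    (M : smooth_manifold R n) (f : M -> 'cV[R]_d) : Prop :=
  [/\ smooth_to_euclidean f, immersive f & topological_embedding f].

(* rho is a group homomorphism from G to Diff(M). *)
Definition smooth_action (R : realType) (n : nat) (M : smooth_manifold R n)
    (G : finGroupType) (rho : G -> M -> M) : Prop :=
  (forall g, diffeomorphism (rho g)) /\
  (forall g h, rho (g * h)%g = rho g \o rho h).

Definition special_orthogonal (R : realType) (m : nat) (A : 'M[R]_m) : Prop :=
  A^T *m A = 1%:M /\ \det A = 1.

Definition equivariant (R : realType) (n m : nat) (M : smooth_manifold R n)
    (G : finGroupType) (rho : G -> M -> M) (e : M -> 'cV[R]_m) : Prop :=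
  exists2 rG : mx_representation R [set: G]%G m,
    (forall g, special_orthogonal (rG g)) &
    (forall g x, e (rho g x) = rG g *m e x).

(* Main.v *)
Require Import Defs.
From HB Require Import structures.
From mathcomp Require Import all_boot all_order all_algebra.
From mathcomp Require Import fingroup mxrepresentation.
From mathcomp Require Import all_classical all_reals all_analysis.

(** Let [f : M -> R^d] be an embedding. The orbit map
    [x |-> (f (g x))_(g in G)] into [R^(d * |G|)] is again a smooth embedding:
    it is smooth because each [f \o rho g] is, and the projection onto the
    block [g = 1] turns it back into [f], so it inherits from [f] injectivity,
    injectivity of the differential and the subspace topology. Moving [x] by
    [h] only permutes the [|G|] blocks, so [h] acts on the target by an
    orthogonal matrix [Q h]. Its determinant may be [-1]; the additional
    coordinate, which is kept equal to [0] along the embedding, repairs this: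
    [h] acts on it by the sign [\det (Q h)], and the total determinant is
    [\det (Q h) ^ 2 = 1].

    The only analysis involved is the stability of [class_C] under
    composition ([class_C_comp]), needed to see that [f \o rho g] is smooth.
    The differential of a composite is expanded in the canonical basis of the
    intermediate space,
    ['d (g \o f) x v = \sum_i ('d f x v)_i *: 'd g (f x) e_i],
    after which the induction on the order of differentiability needs only
    sums, products with scalar functions and linear maps. *)

Set Implicit Arguments.
Unset Strict Implicit.
Unset Printing Implicit Defensive.

Import Order.TTheory GRing.Theory Num.Theory.
Import numFieldNormedType.Exports.
Local Open Scope classical_set_scope.
Local Open Scope ring_scope.

(** * Differentials of germs, products and linear maps *)

Section Differential.
Context {R : realType}.
Implicit Types V W : normedModType R.

(** This gives the dependence of the differential on the germ alone
    ([near_eq_is_diff]): two maps that agree near [x] differ by such an [h]. *)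
Lemma is_diff_near0 V W (h : V -> W) (x : V) :
  (\forall y \near x, h y = 0) -> is_diff x h 0.
Proof.
move=> h0; have hx : h x = 0 by exact: nbhs_singleton h0.
have ho : h \o shift x = cst (h x) + (\0 : {linear V -> W}) +o_ 0 id.
  apply/eqaddoP => _/posnumP[e].
  move: h0; rewrite (near_shift 0 x) => h0; apply: filterS h0 => y /=.
  rewrite subr0 => hy; rewrite !fctE /= hy hx addr0 subrr normr0.
  exact: mulr_ge0.
have dh : 'd h x = (\0 : {linear V -> W}) :> (V -> W).
  by apply: diff_unique ho; exact: cst_continuous.
apply: DiffDef; last exact: dh.
by apply/diff_locallyP; rewrite dh; split; first exact: cst_continuous.
Qed.

Lemma near_eq_is_diff V W (f g : V -> W) (x : V) :
  (\forall y \near x, f y = g y) -> differentiable f x ->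
  is_diff x g ('d f x).
Proof.
move=> fg df.
have gf : is_diff x (g - f) 0.
  by apply: is_diff_near0; apply: filterS fg => y; rewrite !fctE => ->;
    rewrite subrr.
have dff : is_diff x f ('d f x) by exact: differentiableP.
have := is_diffD dff gf; rewrite addrC subrK addr0; exact.
Qed.

(** The product rule, as the differential of the bilinear map [*:%R] composed
    with the pairing of [a] and [h]. *)
Lemma is_diff_scale V W (a : V -> R) (h : V -> W) (x : V) :
  differentiable a x -> differentiable h x ->
  is_diff x (fun y => a y *: h y)
    (fun v => a x *: 'd h x v + 'd a x v *: h x).
Proof.
move=> da dh.
have sbil : bilinear_for
    (GRing.Scale.Law.clone _ _ *:%R _) (GRing.Scale.Law.clone _ _ *:%R _)
    (@GRing.scale R W : R -> W -> W).
  split=> [w|c] k u v /=; first by rewrite scalerDl scalerA.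
  by rewrite scalerDr !scalerA mulrC.
pose sM := bilinear_isBilinear.Build R R W W _ _ _ sbil.
pose s : {bilinear R -> W -> W} := HB.pack (@GRing.scale R W) sM.
have sc : continuous (fun p : R * W => s p.1 p.2).
  by move=> p; exact: scale_continuous.
have ds p : is_diff p (fun q : R * W => s q.1 q.2)
    (fun q => s p.1 q.2 + s q.1 p.2).
  by apply: DiffDef; [exact: differentiable_bilin|exact: diff_bilin].
have := is_diff_comp (is_diff_pair (differentiableP da) (differentiableP dh))
  (ds (a x, h x)).
by [].
Qed.

Lemma diff_linear_comp V W W' (L : {linear W -> W'}) (f : V -> W) (x : V) :
  continuous L -> differentiable f x ->
  'd (L \o f) x = L \o 'd f x :> (V -> W').
Proof.
move=> Lc df; rewrite diff_comp ?diff_lin //.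
exact: linear_differentiable.
Qed.

Lemma linear_cV_sum m W (L : {linear 'cV[R]_m -> W}) (v : 'cV[R]_m) :
  L v = \sum_(i < m) v i 0 *: L (delta_mx i 0).
Proof.
rewrite {1}[v]matrix_sum_delta linear_sum; apply: eq_bigr => i _.
by rewrite big_ord1 linearZ.
Qed.

Lemma linear_cV_continuous m W (L : {linear 'cV[R]_m -> W}) : continuous L.
Proof.
have -> : (L : _ -> _) = fun v => \sum_(i < m) v i 0 *: L (delta_mx i 0).
  by apply/funext => v; exact: linear_cV_sum.
apply: continuous_big => [|i _ v]; first exact: add_continuous.
by apply: continuousZr_tmp; exact: coord_continuous.
Qed.

End Differential.

(** * Calculus of maps of class C^k *)

Section ClassC.
Context {R : realType}.
Implicit Types (V W : normedModType R) (k m : nat).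

(** [U] has to be open because the differentials of [f] and [g] at a point
    agree only if the two maps agree around that point. *)
Lemma class_C_ext k V W (U : set V) (f g : V -> W) :
  open U -> (forall x, U x -> f x = g x) -> class_C k U f -> class_C k U g.
Proof.
move=> Uo; elim: k f g => [|k IH] f g fg.
- move=> fC x Ux; rewrite /prop_for /continuous_at -(fg x Ux).
  apply: cvg_trans (fC x Ux); apply: near_eq_cvg.
  by apply: filterS (open_nbhs_nbhs (conj Uo Ux)) => y /fg.
- move=> [df dfC].
  have dg x : U x -> is_diff x g ('d f x).
    move=> Ux; apply: near_eq_is_diff (df x Ux).
    by apply: filterS (open_nbhs_nbhs (conj Uo Ux)) => y /fg.
  split=> [x Ux|v]; first by have [] := dg x Ux.
  apply: IH (dfC v) => x Ux.
  by have := dg x Ux => dgx; rewrite diff_val.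
Qed.

Lemma class_C_local k V W (U : set V) (f : V -> W) :
  (forall x, U x -> exists2 U', U' x & class_C k U' f) -> class_C k U f.
Proof.
elim: k f => [|k IH] f fC.
- by move=> x Ux; have [U' U'x] := fC x Ux; exact.
- split=> [x Ux|v].
    by have [U' U'x [+ _]] := fC x Ux; exact.
  apply: IH => x Ux.
  by have [U' U'x [_ dfC]] := fC x Ux; exists U' => //; exact: dfC.
Qed.

Lemma class_C_pred k V W (U : set V) (f : V -> W) :
  class_C k.+1 U f -> class_C k U f.
Proof.
elim: k f => [|k IH] f [df dfC].
- by move=> x Ux; exact/differentiable_continuous/df.
- by split=> // v; exact: IH.
Qed.

Lemma class_C_cst k V W (U : set V) (a : W) : class_C k U (fun=> a).
Proof.
elim: k a => [|k IH] a; first by move=> x _; exact: cst_continuous.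
split=> [x _|v]; first exact: differentiable_cst.
rewrite (_ : (fun x => _) = fun=> 0); first exact: IH.
by apply/funext => x; rewrite diff_cst.
Qed.

Lemma class_C_add k V W (U : set V) (f g : V -> W) : open U ->
  class_C k U f -> class_C k U g -> class_C k U (fun x => f x + g x).
Proof.
move=> Uo; elim: k f g => [|k IH] f g.
- by move=> fC gC x Ux; apply: continuousD; [exact: fC|exact: gC].
- move=> [df dfC] [dg dgC]; split=> [x Ux|v].
    by apply: differentiableD; [exact: df|exact: dg].
  apply: class_C_ext (IH _ _ (dfC v) (dgC v)) => // x Ux.
  by rewrite diffD //; [exact: df|exact: dg].
Qed.

Lemma class_C_sum k V W (U : set V) (I : finType) (f : I -> V -> W) :
  open U -> (forall i, class_C k U (f i)) ->
  class_C k U (fun x => \sum_i f i x).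
Proof.
move=> Uo fC; elim: (index_enum I) => [|i s IH].
  under eq_fun do rewrite big_nil; exact: class_C_cst.
under eq_fun do rewrite big_cons; exact: class_C_add.
Qed.

Lemma class_C_linear k V W W' (U : set V) (L : {linear W -> W'}) (f : V -> W) :
  open U -> continuous L -> class_C k U f -> class_C k U (L \o f).
Proof.
move=> Uo Lc; elim: k f => [|k IH] f.
- by move=> fC x Ux; apply: continuous_comp; [exact: fC|exact: Lc].
- move=> [df dfC]; split=> [x Ux|v].
    by apply: differentiable_comp; [exact: df|exact: linear_differentiable].
  apply: class_C_ext (IH _ (dfC v)) => // x Ux.
  by rewrite diff_linear_comp //; exact: df.
Qed.

Lemma class_C_coord k V m (U : set V) (f : V -> 'cV[R]_m) (i : 'I_m) :
  open U -> class_C k U f -> class_C k U (fun x => f x i 0 : R).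
Proof.
move=> Uo fC.
have clin : linear (fun v : 'cV[R]_m => v i 0 : R).
  by move=> a u v; rewrite !mxE.
pose cM := GRing.isLinear.Build R 'cV[R]_m R _ _ clin.
pose c : {linear 'cV[R]_m -> R} := HB.pack (fun v : 'cV[R]_m => v i 0 : R) cM.
by apply: (@class_C_linear _ _ _ _ _ c) => //; exact: linear_cV_continuous.
Qed.

Lemma class_C_scale k V W (U : set V) (a : V -> R) (h : V -> W) : open U ->
  class_C k U a -> class_C k U h -> class_C k U (fun x => a x *: h x).
Proof.
move=> Uo; elim: k a h => [|k IH] a h.
- by move=> aC hC x Ux; apply: continuousZ; [exact: aC|exact: hC].
- move=> aC hC; have [[da daC] [dh dhC]] := (aC, hC).
  have dah x : U x -> is_diff x (fun y => a y *: h y)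
      (fun v => a x *: 'd h x v + 'd a x v *: h x).
    by move=> Ux; apply: is_diff_scale; [exact: da|exact: dh].
  split=> [x Ux|v]; first by have [] := dah x Ux.
  apply: (@class_C_ext _ _ _ _ (fun x => a x *: 'd h x v + 'd a x v *: h x)).
  + exact: Uo.
  + by move=> x Ux; have := dah x Ux => dahx; rewrite diff_val.
  + apply: class_C_add Uo _ _.
      exact: IH (class_C_pred aC) (dhC v).
    exact: IH (daC v) (class_C_pred hC).
Qed.

(** The chain rule alone does not close the induction, since
    ['d g (f x) ('d f x v)] depends on [x] also through the direction in which
    [g] is differentiated. Expanding that direction in the canonical basis
    leaves the composites of the maps [fun y => 'd g y e_i] with [f], which are
    covered by the induction hypothesis. *)
Lemma class_C_comp k V W m (U : set V) (U' : set 'cV[R]_m)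
    (f : V -> 'cV[R]_m) (g : 'cV[R]_m -> W) :
  open U -> (forall x, U x -> U' (f x)) ->
  class_C k U f -> class_C k U' g -> class_C k U (g \o f).
Proof.
move=> Uo fU; elim: k f g fU => [|k IH] f g fU.
- by move=> fC gC x Ux; apply: continuous_comp; [exact: fC|exact/gC/fU].
- move=> fC gC; have [[df dfC] [dg dgC]] := (fC, gC).
  have dfx x : U x -> differentiable f x by exact: df.
  have dgx x : U x -> differentiable g (f x) by move=> Ux; exact/dg/fU.
  split=> [x Ux|v]; first by apply: differentiable_comp; auto.
  apply: (@class_C_ext _ _ _ _ (fun x =>
    \sum_(i < m) 'd f x v i 0 *: ((fun y => 'd g y (delta_mx i 0)) \o f) x)).
  + exact: Uo.
  + move=> x Ux.
    have -> : 'd (g \o f) x v = 'd g (f x) ('d f x v).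
      by rewrite diff_comp; auto.
    exact/esym/(linear_cV_sum ('d g (f x))).
  + apply: class_C_sum => // i; apply: class_C_scale => //.
      by apply: class_C_coord => //; exact: dfC.
    exact: IH _ _ fU (class_C_pred fC) (dgC _).
Qed.

End ClassC.

(** * Smooth maps from a manifold to Euclidean space *)

Section Manifold.
Context {R : realType}.

(** The image is the preimage of [W] under [chart_inv c] within the open set
    [c @` chart_dom c], on which [chart_inv c] is continuous. *)
Lemma chart_img_open_setI n (M : topologicalType) (c : chart R n M)
    (W : set M) :
  open W -> open (c @` (chart_dom c `&` W)).
Proof.
move=> Wo; rewrite openE => _ [x [cx Wx] <-]; rewrite /interior.
have cix : (c @` chart_dom c) (c x) by exists x.
have Wn : nbhs (c x) (chart_inv c @^-1` W).
  apply: (@chart_inv_continuous _ _ _ c _ cix).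
  by rewrite chart_mapK //; exact: open_nbhs_nbhs.
have cn := open_nbhs_nbhs (conj (@chart_img_open _ _ _ c) cix).
apply: filterS (filterI cn Wn) => _ [[z cz <-]]; rewrite /= chart_mapK // => Wz.
by exists z.
Qed.

(** No single chart of [N] need contain the image of a chart domain of [M], so
    the coordinate expression of [g \o f] factors through a chart [c'] of [N]
    only locally, on the part of the domain that [f] maps into that of [c']. *)
Lemma smooth_to_euclidean_comp m n d (M : smooth_manifold R m)
    (N : smooth_manifold R n) (f : M -> N) (g : N -> 'cV[R]_d) :
  smooth_map f -> smooth_to_euclidean g -> smooth_to_euclidean (g \o f).
Proof.
move=> [fc fC] gC c ac k; apply: class_C_local => _ [x cx <-].
have [c' ac' c'x] := atlas_cover (f x).
have Uo : open (c @` (chart_dom c `&` f @^-1` (chart_dom c'))).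
  by apply: chart_img_open_setI; apply: open_comp => [z _|];
    [exact: fc|exact: chart_dom_open].
exists (c @` (chart_dom c `&` f @^-1` (chart_dom c'))); first by exists x.
apply: (@class_C_ext _ _ _ _ _
  ((g \o chart_inv c') \o (c' \o f \o chart_inv c))).
- exact: Uo.
- by move=> _ [z [cz c'z] <-] /=; rewrite !chart_mapK.
- apply: class_C_comp (fC _ _ ac ac' k) (gC _ ac' k) => //.
  by move=> _ [z [cz c'z] <-] /=; rewrite chart_mapK //; exists (f z).
Qed.

Lemma smooth_to_euclidean_mulmx n d d' (M : smooth_manifold R n)
    (A : 'M[R]_(d', d)) (f : M -> 'cV[R]_d) :
  smooth_to_euclidean f -> smooth_to_euclidean (fun x => A *m f x).
Proof.
move=> fC c ac k.
apply: (class_C_linear (L := mulmx A)) (fC c ac k).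
- exact: chart_img_open.
- exact: linear_cV_continuous.
Qed.

Lemma smooth_to_euclidean_sum n d (M : smooth_manifold R n) (I : finType)
    (f : I -> M -> 'cV[R]_d) :
  (forall i, smooth_to_euclidean (f i)) ->
  smooth_to_euclidean (fun x => \sum_i f i x).
Proof.
move=> fC c ac k; apply: (class_C_sum (f := fun i => f i \o chart_inv c)).
- exact: chart_img_open.
- by move=> i; exact: fC.
Qed.

(** A linear left inverse of [e] over [f] transports every property of an
    embedding: if [P *m e x = f x], then [P] also maps the differential of [e]
    to that of [f], and [e @` U] is cut out of the range of [e] by the preimage
    under [P] of an open set cutting [f @` U] out of the range of [f]. *)
Lemma smooth_embedding_lift n d d' (M : smooth_manifold R n)
    (P : 'M[R]_(d, d')) (e : M -> 'cV[R]_d') (f : M -> 'cV[R]_d) :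
  continuous e -> smooth_to_euclidean e -> (forall x, P *m e x = f x) ->
  smooth_embedding f -> smooth_embedding e.
Proof.
move=> ec eC Pe [fC fI [fc finj fO]].
have Pc : continuous (mulmx P : 'cV[R]_d' -> 'cV[R]_d).
  exact: linear_cV_continuous.
split=> //; last split=> //.
- move=> c ac x cx v w evw; apply: (fI c ac x cx).
  have -> : f \o chart_inv c = mulmx P \o (e \o chart_inv c).
    by apply/funext => y /=; rewrite Pe.
  have de : differentiable (e \o chart_inv c) (c x).
    by have [+ _] := eC c ac 1%N; apply; exists x.
  by rewrite (diff_linear_comp (L := mulmx P)) //= evw.
- by move=> x y exy; apply: finj; rewrite -!Pe exy.
- move=> U Uo; have [V Vo fUV] := fO U Uo.
  exists (mulmx P @^-1` V).
    by apply: open_comp => // z _; exact: Pc.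
  apply/seteqP; split=> [_ [x Ux <-]|_ [[x _ <-]]].
    split; first by exists x.
    have : (f @` U) (f x) by exists x.
    by rewrite fUV => -[_ Vx]; rewrite /= Pe.
  rewrite /= Pe => Vx.
  have [y Uy /finj <-] : (f @` U) (f x) by rewrite fUV; split=> //; exists x.
  by exists y.
Qed.

End Manifold.

(** * The permutation representation on copies of R^d indexed by G *)

Section BlockPermutation.
Context {R : realType} {G : finGroupType} (d : nat).

(** The inclusion of [R^d] as the block of index [g] of [R^(d * |G|)]. *)
Definition block_incl (g : G) : 'M[R]_(d * #|G|, d) :=
  \matrix_(k, j) (mxvec_index j (enum_rank g) == k)%:R.

Lemma block_incl_ortho g h :
  (block_incl g)^T *m block_incl h = (g == h)%:R *: 1%:M.
Proof.
apply/matrixP => i j; rewrite !mxE.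
rewrite (bigD1 (mxvec_index i (enum_rank g))) //= big1 => [|k /negPf kN].
  rewrite !mxE eqxx mul1r addr0 -natrM mulnb.
  congr (_ %:R); congr (nat_of_bool _).
  have inj := bij_inj (onT_bij (@curry_mxvec_bij d #|G|)).
  rewrite eq_sym [RHS]andbC -(inj_eq (@enum_rank_inj G)).
  exact: (inj_eq inj (i, enum_rank g) (j, enum_rank h)).
by rewrite !mxE eq_sym kN mul0r.
Qed.

Lemma block_incl_complete :
  \sum_g block_incl g *m (block_incl g)^T = 1%:M.
Proof.
apply/matrixP => a b; rewrite summxE.
under eq_bigr do rewrite mxE.
rewrite (reindex_onto (@enum_val G G) (@enum_rank G)) /=; last first.
  by move=> g _; rewrite enum_rankK.
under eq_bigl do rewrite enum_valK eqxx.
rewrite exchange_big pair_big /=.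
transitivity (\sum_k (k == a)%:R * (k == b)%:R : R).
  rewrite [RHS](reindex _ (curry_mxvec_bij d #|G|)).
  by apply: eq_big => [[j i]|[j i] _] //=; rewrite !mxE enum_valK.
rewrite (bigD1 a) //= big1 => [|k /negPf ->]; last by rewrite mul0r.
by rewrite eqxx mul1r addr0 !mxE.
Qed.

(** The permutation matrix for which the block of index [g] of the image is the
    block of index [g * h] of the argument. Written as a sum over the blocks, it
    is handled through the orthogonality and completeness of [block_incl] alone,
    without reference to matrix entries. *)
Definition block_perm (h : G) : 'M[R]_(d * #|G|) :=
  \sum_g block_incl g *m (block_incl (g * h)%g)^T.

Lemma block_perm_incl h g :
  block_perm h *m block_incl g = block_incl (g * h^-1)%g.
Proof.
rewrite mulmx_suml (bigD1 (g * h^-1)%g) //= -mulmxA mulgKV block_incl_ortho.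
rewrite eqxx scale1r mulmx1 big1 ?addr0 // => k kN.
rewrite -mulmxA block_incl_ortho (_ : _ == _ = false) ?scale0r ?mulmx0 //.
by apply: contraNF kN => /eqP <-; rewrite mulgK.
Qed.

Lemma block_perm1 : block_perm 1%g = 1%:M.
Proof.
by rewrite -block_incl_complete; apply: eq_bigr => g _; rewrite mulg1.
Qed.

Lemma block_permM h k : block_perm (h * k)%g = block_perm h *m block_perm k.
Proof.
rewrite [in RHS]/block_perm mulmx_sumr.
rewrite (reindex_inj (mulIg h)); apply: eq_bigr => g _.
by rewrite mulmxA block_perm_incl mulgK mulgA.
Qed.

Lemma block_permT h : (block_perm h)^T = block_perm h^-1%g.
Proof.
rewrite /block_perm linear_sum /= (reindex_inj (mulIg h^-1%g)).
by apply: eq_bigr => g _; rewrite mulgKV trmx_mul trmxK.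
Qed.

Lemma block_perm_orthogonal h : (block_perm h)^T *m block_perm h = 1%:M.
Proof. by rewrite block_permT -block_permM mulVg block_perm1. Qed.

End BlockPermutation.

(** * Correcting the determinant *)

Section DetCorrection.
Context {R : realType} (n : nat).

(** Adjoining the sign [\det Q] keeps [Q |-> det_correction Q] multiplicative
    while making the determinant of an orthogonal [Q] equal to a square. *)
Definition det_correction (Q : 'M[R]_n) : 'M[R]_(n + 1) :=
  block_mx Q 0 0 (\det Q)%:M.

Lemma det_correction_special (Q : 'M[R]_n) :
  Q^T *m Q = 1%:M -> special_orthogonal (det_correction Q).
Proof.
move=> QQ; have detQ2 : \det Q * \det Q = 1.
  by rewrite -{1}det_tr -det_mulmx QQ det1.
split; last by rewrite det_ublock det_scalar1.
rewrite tr_block_mx !trmx0 tr_scalar_mx mulmx_block !mulmx0 !mul0mx.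
by rewrite !addr0 !add0r QQ -scalar_mxM detQ2 -scalar_mx_block.
Qed.

Lemma det_correction1 : det_correction 1%:M = 1%:M.
Proof. by rewrite /det_correction det1 -scalar_mx_block. Qed.

Lemma det_correctionM (Q S : 'M[R]_n) :
  det_correction (Q *m S) = det_correction Q *m det_correction S.
Proof.
rewrite /det_correction mulmx_block !mulmx0 !mul0mx !addr0 !add0r.
by rewrite det_mulmx scalar_mxM.
Qed.

End DetCorrection.

Theorem proposition1p2 (R : realType) (n : nat) (M : smooth_manifold R n)
    (G : finGroupType) (rho : G -> M -> M) (d : nat) :
  closed_manifold M -> connected_manifold M ->
  smooth_action rho -> injective rho ->
  (exists f : M -> 'cV[R]_d, smooth_embedding f) ->
  exists2 e : M -> 'cV[R]_(d * #|G| + 1)%N,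
    smooth_embedding e & equivariant rho e.
Proof.
move=> _ _ [rhoD rhoM] _ [f fE]; have [fC _ [fc _ _]] := fE.
have rhoC g : smooth_map (rho g) by have [] := rhoD g.
(* A multiplicative map only makes [rho 1] idempotent; it is the identity
   because it is also invertible. *)
have rho1 x : rho 1%g x = x.
  have [_ [r [_ rK _]]] := rhoD 1%g.
  by rewrite -[RHS]rK -[in RHS](mulg1 1%g) rhoM /= rK.
pose A g : 'M[R]_(d * #|G| + 1, d) := col_mx (block_incl d g) 0.
pose e x := \sum_g A g *m f (rho g x).
have ec : continuous e.
  apply: continuous_big => [|g _ x]; first exact: add_continuous.
  apply: (@continuous_comp _ _ _ (f \o rho g) (mulmx (A g))).
    by apply: continuous_comp; [exact: (rhoC g).1|exact: fc].
  exact: linear_cV_continuous.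
exists e.
- apply: (@smooth_embedding_lift _ _ _ _ _ (A 1%g)^T e f) => //.
  + apply: smooth_to_euclidean_sum => g; apply: smooth_to_euclidean_mulmx.
    exact: smooth_to_euclidean_comp (rhoC g) fC.
  + move=> x; rewrite mulmx_sumr (bigD1 1%g) //= big1 => [|g gN1].
      rewrite mulmxA tr_col_mx mul_row_col block_incl_ortho eqxx scale1r.
      by rewrite mulmx0 !addr0 mul1mx rho1.
    rewrite mulmxA tr_col_mx mul_row_col block_incl_ortho eq_sym (negPf gN1).
    by rewrite scale0r mulmx0 addr0 mul0mx.
- pose rG (h : G) := det_correction (block_perm (R := R) d h).
  have rGr : mx_repr [set: G]%G rG.
    split=> [|h k _ _]; first by rewrite /rG block_perm1 det_correction1.
    by rewrite /rG block_permM det_correctionM.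
  exists (MxRepresentation rGr) => [h|h x] /=.
    exact/det_correction_special/block_perm_orthogonal.
  rewrite /e mulmx_sumr [RHS](reindex_inj (mulIg h)).
  apply: eq_bigr => g _; rewrite mulmxA /rG mul_block_col block_perm_incl.
  by rewrite mulgK !mul0mx mulmx0 !addr0 rhoM.
Qed.
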